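(* For every $n\ge 1$ the genus distribution of the closed-end ladder $L_n$ is log-concave, and its peak $p_L(n)$ satisfies $$p_L(n)=\Big[\frac{n+2}{3}\Big]\quad\text{if } n\ge 2.$$
   Context: $[x]$ denotes the largest integer not exceeding $x$. The closed-end ladder $L_n$ is the cubic multigraph with vertices $u_1,\dots,u_n,v_1,\dots,v_n$ and edges $u_lu_{l+1}$, $v_lv_{l+1}$ ($1\le l\le n-1$), the rungs $u_lv_l$ ($1\le l\le n$), and in addition one extra edge joining $u_1$ and $v_1$ and one extra edge joining $u_n$ and $v_n$ (closing the two ends; for $n=1$ there are three parallel edges). For a graph $G$, $g_i(G)$ is the number of 2-cell embeddings of $G$ on the orientable surface of genus $i$ (embeddings counted as rotation systems), and the genus distribution of $G$ is the sequence $g_\gamma(G),g_{\gamma+1}(G),\dots,g_{\gamma_M}(G)$ with $\gamma,\gamma_M$ the minimum and maximum genus of $G$. A finite sequence of nonnegative numbers is log-concave if $a_i^2\ge a_{i-1}a_{i+1}$ for all interior indices $i$. It is unimodal if $a_q\le\cdots\le a_{l-1}<a_l=\cdots=a_m>a_{m+1}\ge\cdots\ge a_n$ for some $q\le l\le m\le n$; if $l=m$, then $m$ is called the peak (indices are genera). *)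

(* Defs.v *)
From mathcomp Require Import all_boot all_fingroup.

Set Implicit Arguments.
Unset Strict Implicit.
Unset Printing Implicit Defensive.

(* Loops and parallel edges are allowed; edge [e] has the two ends
   [endpoint e false] and [endpoint e true]. *)
Record multigraph := Multigraph {
  vertex : finType;
  edge : finType;
  endpoint : edge -> bool -> vertex
}.

Section Embeddings.
Variable G : multigraph.

(* The dart (e, b) is the half-edge of e at its end b. *)
Definition dart : finType := (edge G * bool)%type.

Definition dart_vertex (d : dart) : vertex G := endpoint d.1 d.2.

Definition opposite (d : dart) : dart := (d.1, ~~ d.2).

Lemma oppositeK : involutive opposite.
Proof. by case=> e b; rewrite /opposite /= negbK. Qed.

Definition opposite_perm : {perm dart} := perm (inv_inj oppositeK).

(* A rotation system: one cyclic order of the darts at each vertex, i.e. the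
   cycles of [s] are exactly the sets of darts at a common vertex. *)
Definition rotation_system (s : {perm dart}) : bool :=
  [forall d, porbit s d == [set d' | dart_vertex d' == dart_vertex d]].

(* Faces are the cycles of the face-tracing permutation d |-> s (opposite d)
   (products in {perm _} are applied from left to right). *)
Definition face_count (s : {perm dart}) : nat :=
  #|porbits (opposite_perm * s)%g|.

(* The Euler relation V - E + F = 2 - 2 i, without subtraction.  It gives the
   genus of the surface for connected graphs with at least one edge, the only
   case in which rotation systems describe 2-cell embeddings in this way. *)
Definition has_genus (s : {perm dart}) (i : nat) : bool :=
  #|vertex G| + face_count s + 2 * i == #|edge G| + 2.

Definition genus_count (i : nat) : nat :=
  #|[set s : {perm dart} | rotation_system s && has_genus s i]|.

(* V, F >= 1 in the Euler relation give 2 i <= E, so that the bound on i below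
   excludes no genus. *)
Definition min_genus : nat :=
  \big[minn/#|edge G|]_(i < #|edge G|.+1 | 0 < genus_count i) i.

Definition max_genus : nat :=
  \max_(i < #|edge G|.+1 | 0 < genus_count i) i.

End Embeddings.

(* The predicates below concern the finite sequence a_q, ..., a_n. *)

Definition log_concave (a : nat -> nat) (q n : nat) : Prop :=
  forall i, q < i -> i < n -> a i.-1 * a i.+1 <= a i ^ 2.

(* a_q <= ... <= a_(l-1) < a_l = ... = a_m > a_(m+1) >= ... >= a_n *)
Definition unimodal_with (a : nat -> nat) (q n l m : nat) : Prop :=
  [/\ q <= l, l <= m & m <= n] /\
  [/\ forall i, q <= i -> i.+1 < l -> a i <= a i.+1,
      q < l -> a l.-1 < a l,
      forall i, l <= i -> i <= m -> a i = a l,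
      m < n -> a m.+1 < a m
    & forall i, m < i -> i < n -> a i.+1 <= a i].

Definition is_peak (a : nat -> nat) (q n m : nat) : Prop :=
  unimodal_with a q n m m.

Definition genus_distribution_log_concave (G : multigraph) : Prop :=
  log_concave (genus_count G) (min_genus G) (max_genus G).

Definition is_genus_distribution_peak (G : multigraph) (p : nat) : Prop :=
  is_peak (genus_count G) (min_genus G) (max_genus G) p.

(* For n >= 1 the type 'I_n.-1.+1 is 'I_n, with indices starting at 0; the
   predecessor only serves to have a first and a last index.  The junk value
   at n = 0 is L_1. *)
Section ClosedEndLadder.
Variable n : nat.

(* (false, l) is u_(l+1) and (true, l) is v_(l+1). *)
Definition ladder_vertex : finType := (bool * 'I_n.-1.+1)%type.

(* Rails, rungs, and the two extra end edges. *)
Definition ladder_edge : finType := ((bool * 'I_n.-1) + ('I_n.-1.+1 + bool))%type.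

Definition ladder_endpoint (e : ladder_edge) (b : bool) : ladder_vertex :=
  match e with
  | inl (side, l) => (side, if b then lift ord0 l else widen_ord (leqnSn n.-1) l)
  | inr (inl l) => (b, l)
  | inr (inr last_end) => (b, if last_end then ord_max else ord0)
  end.

Definition closed_end_ladder : multigraph := Multigraph ladder_endpoint.

End ClosedEndLadder.

(* Main.v *)
(** Cut the ladder between two consecutive rungs. Inside the left part the two
    strands that enter through the cut are paired up in one of two ways: each
    returns along the other rail, or each returns along its own rail. Adding a
    rung to the left end only changes this pairing and possibly completes one
    face, according to whether the rotations at the two ends of the rung agree.
    This gives a transfer recursion for the number of faces, whence
    g_i(L_{n+2}) = 2 g_i(L_{n+1}) + 8 g_{i-1}(L_n) and
    g_i(L_n) = 2^(n-1+i) (C(n+1-i,i) + C(n-i,i)). With j = n - 1 - 2i the ratio of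
    consecutive terms is
    g_{i+1} / g_i = 2 (j+2)(j+1)(i+2j+1) / ((i+1)(i+j+1)(i+2j+4));
    it decreases in i, and for n >= 2 it exceeds 1 exactly when 3(i+1) <= n+2. *)

Require Import Defs.
From mathcomp Require Import all_boot all_fingroup zify ring.

Set Implicit Arguments.
Unset Strict Implicit.
Unset Printing Implicit Defensive.

(** * Cycles of a permutation counted through a section *)

Lemma leq_card_imset_ker (A B C : finType) (u : A -> B) (v : A -> C) :
  (forall x y, v x = v y -> u x = u y) -> #|u @: A| <= #|v @: A|.
Proof.
move=> vu; pose w c := omap u [pick x | v x == c].
rewrite -(card_imset _ (_ : injective Some)) => [|? ? [] //].
apply: leq_trans (leq_imset_card w _).
apply/subset_leq_card/subsetP=> _ /imsetP[_ /imsetP[x _ ->] ->].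
apply/imsetP; exists (v x); first exact: imset_f.
rewrite /w; case: pickP => [y /eqP vy /=|/(_ x)]; last by rewrite eqxx.
by rewrite (vu _ _ vy).
Qed.

Lemma porbit_step (T : finType) (f : {perm T}) x : porbit f (f x) = porbit f x.
Proof. exact: (porbit_perm f 1 x). Qed.

Lemma mem_porbit_step (T : finType) (f : {perm T}) x y :
  (f x \in porbit f y) = (x \in porbit f y).
Proof. by rewrite -!eq_porbit_mem porbit_step. Qed.

(** Think of [h] as a section of [f]. A point on a cycle that meets the section is sent by [c] to a
    section point on that cycle, and [g] acts as a return map. The points sent to [None] lie on a
    single further cycle. *)
Lemma card_porbits_return (T T' : finType) (f : {perm T}) (g : {perm T'})
    (h : T' -> T) (c : T -> option T') :
  (forall x, c (h x) = Some x) ->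
  (forall t x, c t = Some x -> t \in porbit f (h x)) ->
  (forall t t', c t = None -> c t' = None -> t' \in porbit f t) ->
  (forall t, omap (porbit g) (c (f t)) = omap (porbit g) (c t)) ->
  (forall x, h (g x) \in porbit f (h x)) ->
  #|porbits f| = #|porbits g| + [exists t, c t == None].
Proof.
move=> ch c_some c_none cf hg.
(* [Phi] is a complete invariant of the [f]-cycles, so they are counted by its image. *)
pose Phi t := omap (porbit g) (c t).
have Phi_porbit t t' : porbit f t = porbit f t' -> Phi t = Phi t'.
  move/eqP; rewrite eq_porbit_mem => /porbitP[i ->].
  by elim: i => [|i IHi]; rewrite ?perm1 // expgSr permM /Phi cf.
have h_porbit x x' : porbit g x = porbit g x' -> porbit f (h x) = porbit f (h x').
  move/eqP; rewrite eq_porbit_mem => /porbitP[i ->].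
  elim: i => [|i IHi]; first by rewrite perm1.
  by rewrite expgSr permM -IHi; apply/eqP; rewrite eq_porbit_mem.
have porbit_Phi t t' : Phi t = Phi t' -> porbit f t = porbit f t'.
  rewrite /Phi; case ct: (c t) => [x|]; case ct': (c t') => [x'|] //=.
    move=> [/h_porbit xx']; move: (c_some _ _ ct) (c_some _ _ ct').
    by rewrite -!eq_porbit_mem => /eqP-> /eqP->.
  by move=> _; apply/eqP; rewrite eq_porbit_mem; apply: c_none.
have -> : #|porbits f| = #|Phi @: T|.
  by apply/eqP; rewrite eqn_leq !leq_card_imset_ker.
rewrite -(card_imset (porbits g) (_ : injective Some)) => [|? ? [] //].
have -> : Phi @: T =
    Some @: porbits g :|: (if [exists t, c t == None] then [set None] else set0).
  apply/setP=> z; apply/imsetP/setUP.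
    case=> t _ ->; rewrite /Phi; case ct: (c t) => [x|] /=.
      by left; apply/imset_f/imset_f.
    by right; case: existsP => [|[]]; [rewrite inE | exists t; rewrite ct].
  case=> [/imsetP[_ /imsetP[x _ ->] ->]|].
    by exists (h x); rewrite // /Phi ch.
  case: existsP => [[t /eqP ct]|]; rewrite inE // => /eqP->.
  by exists t; rewrite // /Phi ct.
rewrite cardsU [_ :&: _](_ : _ = set0) ?cards0 ?subn0.
  by congr (_ + _); case: ifP; rewrite ?cards1 ?cards0.
apply/setP=> z; rewrite !inE; apply/negbTE/negP=> /andP[/imsetP[y _ ->]].
by case: ifP; rewrite inE.
Qed.

(** * Coordinates on the darts, and face tracing on the ladder *)

Inductive side := Back | Forth | Rung.

(** A cubic vertex has just two rotations, the cyclic order [Back], [Forth], [Rung] and its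
    reverse. *)
Definition turn (o : bool) (x : side) : side :=
  match x, o with
  | Back, true | Rung, false => Forth
  | Forth, true | Back, false => Rung
  | Rung, true | Forth, false => Back
  end.

Lemma turnK o : cancel (turn o) (turn (~~ o)).
Proof. by case: o => -[]. Qed.

Section LadderFaces.
Variable N : nat.

Local Notation ldart := (dart (closed_end_ladder N.+1)).
Implicit Types (d : ldart) (b : bool) (l : 'I_N.+1) (r : bool * 'I_N.+1 -> bool).

(** The extra end edges supply the missing [Back] and [Forth] darts of the first and last rungs,
    where [unlift] yields [None]. Every vertex thus has the same three sides. *)
Definition dart_at b l (x : side) : ldart :=
  match x with
  | Back => if unlift ord0 l is Some j then (inl (b, j), true)
            else (inr (inr false), b)
  | Forth => if unlift ord_max l is Some j then (inl (b, j), false)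
             else (inr (inr true), b)
  | Rung => (inr (inl l), b)
  end.

Definition side_of d : side :=
  match d.1 with
  | inl _ => if d.2 then Back else Forth
  | inr (inl _) => Rung
  | inr (inr last_end) => if last_end then Forth else Back
  end.

Definition vertex_of d : bool * 'I_N.+1 := dart_vertex d.

Lemma lift_max_widen (j : 'I_N) : lift ord_max j = widen_ord (leqnSn N) j.
Proof. by apply: val_inj; exact: lift_max. Qed.

Lemma side_of_dart_at b l x : side_of (dart_at b l x) = x.
Proof. by case: x; rewrite /dart_at //; case: unliftP. Qed.

Lemma vertex_of_dart_at b l x : vertex_of (dart_at b l x) = (b, l).
Proof.
case: x; rewrite /dart_at //; case: unliftP => [j ->|->] //.
by rewrite /vertex_of /dart_vertex /= -lift_max_widen.
Qed.

Lemma dart_atE d : dart_at (vertex_of d).1 (vertex_of d).2 (side_of d) = d.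
Proof.
case: d => [[[b j]|[l|[]]] [|]] //=; rewrite /side_of /= ?liftK ?unlift_none //.
  by rewrite -lift_max_widen liftK.
Qed.

Definition rotate r d : ldart :=
  dart_at (vertex_of d).1 (vertex_of d).2 (turn (r (vertex_of d)) (side_of d)).

Lemma rotate_dart_at r b l x :
  rotate r (dart_at b l x) = dart_at b l (turn (r (b, l)) x).
Proof. by rewrite /rotate vertex_of_dart_at side_of_dart_at. Qed.

Lemma rotateK r : cancel (rotate r) (rotate (negb \o r)).
Proof.
move=> d; rewrite -[d]dart_atE !rotate_dart_at.
by rewrite -surjective_pairing /= turnK.
Qed.

Definition rotation r : {perm ldart} := perm (can_inj (rotateK r)).

(* The two strands that leave the ladder through its first end return from the
   other side if [p], and from the same side otherwise. *)
Definition flip_dart (p : bool) d : ldart :=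
  match d with
  | (inr (inr false), b) => (inr (inr false), p (+) b)
  | (e, b) => (e, ~~ b)
  end.

Lemma flip_dartK p : involutive (flip_dart p).
Proof. by case=> [[?|[?|[]]] b] /=; rewrite ?negbK ?addKb. Qed.

(** Only [p = true] traces the faces of the ladder itself; [p = false] arises when rungs are
    absorbed into the left part. *)
Definition trace p r : {perm ldart} :=
  (perm (inv_inj (flip_dartK p)) * rotation r)%g.

Lemma traceE p r d : trace p r d = rotate r (flip_dart p d).
Proof. by rewrite permM !permE. Qed.

Lemma trace_true r : trace true r = (opposite_perm _ * rotation r)%g.
Proof. by congr (_ * _)%g; apply/permP=> -[[?|[?|[]]] b]; rewrite !permE. Qed.

End LadderFaces.

(** * Faces passing through the first rung *)

Definition orient (a : bool * bool) (b : bool) : bool := if b then a.2 else a.1.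

(* Follows the face through dart [x] at end [b] of the first rung backwards to
   the strand [Some b'] along which it came from the right; [None] means that it
   never leaves the rung, provided [n >= 4]. *)
Fixpoint strand p a n b x : option bool :=
  match turn (~~ orient a b) x, n with
  | Forth, _ => Some b
  | Rung, n'.+1 => strand p a n' (~~ b) Rung
  | Back, n'.+1 => strand p a n' (p (+) b) Back
  | _, 0 => None
  end.

(** Bits are read along the rails, so unequal bits are the planar position of a rung: crossing
    strands then stay crossing and a face closes behind the rung. Equal bits turn crossing strands
    into same-side ones; same-side strands always become crossing. *)
Definition next_flip p (a : bool * bool) := p ==> (a.1 (+) a.2).
Definition closes p (a : bool * bool) := p && (a.1 (+) a.2).

Lemma strand_enter p a b : strand p a 4 b (turn (orient a b) Forth) = Some b.
Proof. by case: p a b => -[[] []] []. Qed.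

(** The face leaving on rail [b] came in on rail [next_flip p a (+) b]: seen from the right, the
    rung together with the old pairing acts as the new pairing. *)
Lemma strand_leave p a b : strand p a 4 b Forth = Some (next_flip p a (+) b).
Proof. by case: p a b => -[[] []] []. Qed.

Lemma strand_rung p a b :
  strand p a 4 (~~ b) (turn (orient a (~~ b)) Rung) = strand p a 4 b Rung.
Proof. by case: p a b => -[[] []] []. Qed.

Lemma strand_back p a b :
  strand p a 4 (p (+) b) (turn (orient a (p (+) b)) Back) = strand p a 4 b Back.
Proof. by case: p a b => -[[] []] []. Qed.

Lemma strand_none p a b x : strand p a 4 b x = None -> closes p a.
Proof. by case: p a b x => -[[] []] [] []. Qed.

Lemma closes_strand p a :
  closes p a -> strand p a 4 true (if a.2 then Back else Rung) = None.
Proof. by case: p a => -[[] []]. Qed.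

Section Strands.
Variables (T : finType) (f : {perm T}) (enter : bool -> T) (at0 : bool -> side -> T).
Variables (p : bool) (a : bool * bool).
Hypothesis f_enter : forall b, f (enter b) = at0 b (turn (orient a b) Forth).
Hypothesis f_rung :
  forall b, f (at0 b Rung) = at0 (~~ b) (turn (orient a (~~ b)) Rung).
Hypothesis f_back :
  forall b, f (at0 b Back) = at0 (p (+) b) (turn (orient a (p (+) b)) Back).

(** Each unfolding of [strand] undoes one step of [f] and so stays on the cycle. *)
Lemma strand_porbit n b x b' :
  strand p a n b x = Some b' -> at0 b x \in porbit f (enter b').
Proof.
have turn_turn b1 x1 : turn (orient a b1) (turn (~~ orient a b1) x1) = x1.
  by case: (orient a b1) x1 => -[].
elim: n b x => [|n IHn] b x /=; have := turn_turn b x;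
  case: (turn (~~ _) _) => // bx.
- by case=> <-; rewrite -bx -f_enter mem_porbit_step porbit_id.
- move/IHn; rewrite -mem_porbit_step f_back addKb.
  by rewrite bx.
- by case=> <-; rewrite -bx -f_enter mem_porbit_step porbit_id.
- by move/IHn; rewrite -mem_porbit_step f_rung negbK bx.
Qed.

(** Only two darts never leave the rung, a [Back] at one end and a [Rung] at the other, and [f]
    swaps them. At most one face closes. *)
Lemma strand_none_porbit b x b' x' :
  strand p a 4 b x = None -> strand p a 4 b' x' = None ->
  at0 b' x' \in porbit f (at0 b x).
Proof.
move: f_rung f_back; case: p a b x b' x' => -[[] []] [] [] //= [] [] //= fr fb _ _;
 rewrite ?porbit_id //.
all: by rewrite -1?[at0 false Rung](fb true) -1?[at0 true Rung](fb false)
  ?mem_porbit_step ?porbit_id // porbit_sym mem_porbit_step porbit_id.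
Qed.
End Strands.

(** * Removal of the first rung *)

Section AddRung.
Variables (N : nat) (p : bool) (r : bool * 'I_N.+2 -> bool) (a : bool * bool).
Hypothesis r_ord0 : forall b, r (b, ord0) = orient a b.

Local Notation ldart n := (dart (closed_end_ladder n.+1)).

Let r' (v : bool * 'I_N.+1) := r (v.1, lift ord0 v.2).
Let first_dart n b : ldart n := (inr (inr false), b).
Let f := trace p r.
Let g := trace (next_flip p a) r'.

(** The first end edge of the shorter ladder is cut open: its dart on side [b] becomes the far end
    of the first rail on that side. *)
Definition lift_dart (d : ldart N) : ldart N.+1 :=
  match d with
  | (inl (b, j), e) => (inl (b, lift ord0 j), e)
  | (inr (inl l), e) => (inr (inl (lift ord0 l)), e)
  | (inr (inr true), e) => (inr (inr true), e)
  | (inr (inr false), b) => (inl (b, ord0), true)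
  end.

Lemma lift_dart_at b l x :
  lift_dart (dart_at b l x) = dart_at b (lift ord0 l) x.
Proof.
case: x; rewrite /dart_at //.
  by rewrite liftK; case: unliftP => [j ->|->].
case: unliftP => [j ->|->].
  suff -> : lift ord0 (lift ord_max j) = lift ord_max (lift ord0 j) :> 'I_N.+2.
    by rewrite liftK.
  by apply: val_inj; rewrite /= /bump !leq0n !add1n ltnS leqNgt ltn_ord.
suff -> : lift ord0 ord_max = ord_max :> 'I_N.+2 by rewrite unlift_none.
exact: val_inj.
Qed.

Lemma rotate_lift d : rotate r (lift_dart d) = lift_dart (rotate r' d).
Proof.
rewrite -[d]dart_atE lift_dart_at !rotate_dart_at lift_dart_at.
by rewrite -surjective_pairing.
Qed.

Lemma dart_at_forth b : dart_at b ord0 Forth = (inl (b, ord0), false) :> ldart N.+1.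
Proof.
rewrite /dart_at (_ : ord0 = lift ord_max (ord0 : 'I_N.+1)) ?liftK //.
exact: val_inj.
Qed.

Lemma dart_at_back n b : dart_at b ord0 Back = first_dart n b.
Proof. by rewrite /dart_at unlift_none. Qed.

Let f_enter b :
  f (lift_dart (first_dart N b)) = dart_at b ord0 (turn (orient a b) Forth).
Proof. by rewrite traceE -[flip_dart _ _]dart_at_forth rotate_dart_at r_ord0. Qed.

Let f_rung b :
  f (dart_at b ord0 Rung) = dart_at (~~ b) ord0 (turn (orient a (~~ b)) Rung).
Proof.
by rewrite traceE -[flip_dart _ _]/(dart_at (~~ b) ord0 Rung) rotate_dart_at r_ord0.
Qed.

Let f_back b :
  f (dart_at b ord0 Back) = dart_at (p (+) b) ord0 (turn (orient a (p (+) b)) Back).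
Proof.
rewrite traceE dart_at_back -[flip_dart _ _]/(first_dart _ (p (+) b)).
by rewrite -dart_at_back rotate_dart_at r_ord0.
Qed.

Let q := next_flip p a.

(** Since [flip_dart q] sends the end dart on side [q (+) b] to side [b], leaving the first rung
    along rail [b] amounts to a step of [g] from that end dart. *)
Let f_forth b : f (dart_at b ord0 Forth) = lift_dart (g (first_dart N (q (+) b))).
Proof.
rewrite !traceE -rotate_lift dart_at_forth; congr (rotate r _).
by rewrite /= addKb.
Qed.

Let f_lift d : (forall b, d <> first_dart N b) -> f (lift_dart d) = lift_dart (g d).
Proof.
rewrite !traceE -rotate_lift.
by case: d => [[[b' j]|[l|[]]] b] // /(_ b).
Qed.

(** This is the map [c] of [card_porbits_return]: darts beyond the first rung stay put, and those at
    the first rung go to the strand along which their face came in. *)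
Let drop_dart (d : ldart N.+1) : option (ldart N) :=
  let v := vertex_of d in
  if unlift ord0 v.2 is Some l then Some (dart_at v.1 l (side_of d))
  else omap (first_dart N) (strand p a 4 v.1 (side_of d)).

Let drop_lift d : drop_dart (lift_dart d) = Some d.
Proof.
rewrite -[d]dart_atE lift_dart_at /drop_dart vertex_of_dart_at side_of_dart_at.
by rewrite liftK.
Qed.

Let drop_dart_at b x :
  drop_dart (dart_at b ord0 x) = omap (first_dart N) (strand p a 4 b x).
Proof. by rewrite /drop_dart vertex_of_dart_at side_of_dart_at unlift_none. Qed.

Let dart_split (d : ldart N.+1) :
  (exists d', d = lift_dart d') \/ exists b x, d = dart_at b ord0 x.
Proof.
rewrite -[d]dart_atE; case: (unliftP ord0 (vertex_of d).2) => [l ->|->].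
  by left; exists (dart_at (vertex_of d).1 l (side_of d)); rewrite lift_dart_at.
by right; exists (vertex_of d).1, (side_of d).
Qed.

Let strand_first b x d : drop_dart (dart_at b ord0 x) = Some d ->
  dart_at b ord0 x \in porbit f (lift_dart d).
Proof.
rewrite drop_dart_at; case s: strand => [b'|] //= [<-].
exact: (strand_porbit (enter := lift_dart \o @first_dart N)
          (at0 := fun b => dart_at b ord0) f_enter f_rung f_back s).
Qed.

Lemma card_porbits_add_rung : #|porbits f| = #|porbits g| + closes p a.
Proof.
have first_or d : (exists b, d = first_dart N b) \/ forall b, d <> first_dart N b.
  by case: d => [[?|[?|[]]] b]; [right|right|right|left; exists b].
rewrite (card_porbits_return drop_lift (g := g)); first congr (_ + nat_of_bool _).
- apply/existsP/idP => [[d]|/closes_strand s].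
    case: (dart_split d) => [[d' ->]|[b [x ->]]]; first by rewrite drop_lift.
    by rewrite drop_dart_at; case s: strand => // _; exact: strand_none s.
  by exists (dart_at true ord0 (if a.2 then Back else Rung)); rewrite drop_dart_at s.
- move=> t d; case: (dart_split t) => [[d' ->]|[b [x ->]]].
    by rewrite drop_lift => -[->]; apply: porbit_id.
  exact: strand_first.
- move=> t t'; case: (dart_split t) => [[d ->]|[b [x ->]]]; first by rewrite drop_lift.
  case: (dart_split t') => [[d ->]|[b' [x' ->]]]; first by rewrite drop_lift.
  rewrite !drop_dart_at; case s: strand => //; case s': strand => // _ _.
  exact: (strand_none_porbit (at0 := fun b => dart_at b ord0) f_rung f_back s s').
- move=> t; case: (dart_split t) => [[d ->]|[b [x ->]]].
    case: (first_or d) => [[b ->]|d_nf].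
      by rewrite f_enter drop_dart_at strand_enter drop_lift.
    by rewrite f_lift // !drop_lift /= porbit_step.
  case: x; first by rewrite f_back !drop_dart_at strand_back.
    by rewrite f_forth drop_lift drop_dart_at strand_leave /= porbit_step.
  by rewrite f_rung !drop_dart_at strand_rung.
- move=> d; case: (first_or d) => [[b ->]|d_nf]; last first.
    by rewrite -f_lift // mem_porbit_step porbit_id.
  (* One step of [g] from an end dart is a whole passage of [f] through the first rung, ending with
     a [Forth] dart. *)
  rewrite -[b](addKb q) -f_forth mem_porbit_step; apply: strand_first.
  by rewrite drop_dart_at strand_leave /=.
Qed.

End AddRung.

(** * Face count of the whole ladder, starting from one rung *)

Section OneRung.
Variables (p : bool) (r : bool * 'I_1 -> bool) (a : bool * bool).
Hypothesis r_ord0 : forall b, r (b, ord0) = orient a b.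

Local Notation ldart := (dart (closed_end_ladder 1)).
Let f := trace p r.
Let q := next_flip p a.
Let at0 b x : ldart := dart_at b ord0 x.
Let last_dart b : ldart := (inr (inr true), b).

Let at0_forth b : at0 b Forth = last_dart b.
Proof. by rewrite /at0 /dart_at (_ : ord0 = ord_max) ?unlift_none //; apply: val_inj. Qed.

Let f_forth b : f (at0 b Forth) = at0 (~~ b) (turn (orient a (~~ b)) Forth).
Proof.
rewrite traceE at0_forth -[flip_dart _ _]/(last_dart (~~ b)) -at0_forth.
by rewrite rotate_dart_at r_ord0.
Qed.

Let f_rung b : f (at0 b Rung) = at0 (~~ b) (turn (orient a (~~ b)) Rung).
Proof.
by rewrite traceE -[flip_dart _ _]/(dart_at (~~ b) ord0 Rung) rotate_dart_at r_ord0.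
Qed.

Let f_back b : f (at0 b Back) = at0 (p (+) b) (turn (orient a (p (+) b)) Back).
Proof.
rewrite traceE {1}/at0 dart_at_back.
rewrite -[flip_dart _ _]/((inr (inr false), (p (+) b)) : ldart) -dart_at_back.
by rewrite rotate_dart_at r_ord0.
Qed.

(** The section consists of the two [Forth] darts. The last end edge swaps the rails and the passage
    through the rung adds [q]; the composite is the return map. *)
Let end_strand (b : bool) := ~~ q (+) b.
Let end_strandK : involutive end_strand.
Proof. exact: addKb. Qed.
Let g : {perm bool} := perm (inv_inj end_strandK).

Let drop (d : ldart) : option bool :=
  let b := (vertex_of d).1 in
  if side_of d is Forth then Some b else omap negb (strand p a 4 b (side_of d)).

Let drop_at0 b x : drop (at0 b x) =
  if x is Forth then Some b else omap negb (strand p a 4 b x).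
Proof. by rewrite /drop vertex_of_dart_at side_of_dart_at. Qed.

Let at0E (d : ldart) : exists b x, d = at0 b x.
Proof.
exists (vertex_of d).1, (side_of d); rewrite -[LHS]dart_atE /at0.
by congr dart_at; rewrite ord1.
Qed.

Let f_enter b : f (at0 (~~ b) Forth) = at0 b (turn (orient a b) Forth).
Proof. by rewrite f_forth negbK. Qed.

Let strand_end b x b' :
  strand p a 4 b x = Some b' -> at0 b x \in porbit f (at0 (~~ b') Forth).
Proof.
exact: (strand_porbit (enter := fun b => at0 (~~ b) Forth) f_enter f_rung f_back).
Qed.

Lemma card_porbits_one_rung : #|porbits f| = closes p a + q.+1.
Proof.
have -> : #|porbits f| = #|porbits g| + closes p a.
  rewrite (card_porbits_return (f := f) (g := g) (c := drop) (h := fun b => at0 b Forth)).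
  - congr (_ + nat_of_bool _).
    apply/existsP/idP => [[d]|s].
      have [b [x ->]] := at0E d; rewrite drop_at0.
      by case: x => //; case s: strand => // _; exact: strand_none s.
    exists (at0 true (if a.2 then Back else Rung)); rewrite drop_at0 (closes_strand s).
    by case: a.2.
  - by move=> b; rewrite drop_at0.
  - move=> t b; have [b' [x ->]] := at0E t; rewrite drop_at0.
    case: x => [|[->]|]; rewrite ?porbit_id //;
      by case s: strand => [b1|] //= [<-]; apply: (strand_end s).
  - move=> t t'; have [b [x ->]] := at0E t; have [b' [x' ->]] := at0E t'.
    rewrite !drop_at0 => s s'; apply: (strand_none_porbit f_rung f_back).
      by case: x s => //; case: strand.
    by case: x' s' => //; case: strand.
  - have drop_turn b x : omap (porbit g) (drop (at0 b x)) =
        omap (porbit g) (omap negb (strand p a 4 b x)).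
      rewrite drop_at0; case: x => //; rewrite strand_leave /= -porbit_step permE.
      by rewrite /end_strand /q; case: next_flip b => -[].
    move=> t; have [b [x ->]] := at0E t; case: x.
    + by rewrite f_back !drop_turn strand_back.
    + by rewrite f_forth [LHS]drop_turn strand_enter drop_at0 /= negbK.
    + by rewrite f_rung !drop_turn strand_rung.
  - move=> b; rewrite permE /end_strand.
    have /strand_end := strand_leave p a (~~ q (+) b).
    by rewrite -/q addNb addbN addKb negbK.
rewrite addnC; congr (_ + _).
(* The return map is the identity on two points if [q] holds, and their swap otherwise; hence [q.+1]
   cycles. *)
case: (boolP q) => q_b.
  have -> : g = 1%g by apply/permP=> b; rewrite permE perm1 /end_strand q_b.
  have inj1 : injective (porbit (1%g : {perm bool})).
    move=> b b' /eqP; rewrite eq_porbit_mem => /porbitP[i ->].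
    by rewrite expg1n perm1.
  by rewrite /porbits card_imset // card_bool.
have g_false : g false = true by rewrite permE /end_strand (negbTE q_b).
have porbit_g b : porbit g b = porbit g false.
  by case: b => //; rewrite -g_false porbit_step.
rewrite (_ : porbits g = [set porbit g false]) ?cards1 //.
apply/setP=> B; rewrite !inE; apply/imsetP/eqP => [[b _ ->]|->].
  exact: porbit_g.
by exists false.
Qed.

End OneRung.

(** The final [p.+1] comes from the last end edge, which closes crossing strands into two faces and
    same-side strands into one. *)
Fixpoint faces (p : bool) (s : seq (bool * bool)) : nat :=
  if s is a :: s' then closes p a + faces (next_flip p a) s' else p.+1.

Definition orientation N (t : N.-tuple (bool * bool)) (v : bool * 'I_N) : bool :=
  orient (tnth t v.2) v.1.

Lemma eq_trace N p (r r' : bool * 'I_N.+1 -> bool) :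
  r =1 r' -> trace p r = trace p r'.
Proof. by move=> rr'; apply/permP=> d; rewrite !traceE /rotate rr'. Qed.

Lemma card_porbits_trace N p (t : N.+1.-tuple (bool * bool)) :
  #|porbits (trace p (orientation t))| = faces p t.
Proof.
elim: N p t => [|N IHN] p t; case/tupleP: t => a t /=.
  have r_ord0 b : orientation [tuple of a :: t] (b, ord0) = orient a b.
    by rewrite /orientation tnth0.
  by rewrite (card_porbits_one_rung p r_ord0) [t]tuple0.
have r_ord0 b : orientation [tuple of a :: t] (b, ord0) = orient a b.
  by rewrite /orientation tnth0.
rewrite (card_porbits_add_rung p r_ord0) addnC -IHN.
congr (_ + #|porbits _|); apply: eq_trace => -[b l].
by rewrite /orientation tnthS.
Qed.

(** * Rotation systems as tuples of pairs of bits *)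

Lemma turn_derangement (m : side -> side) :
  injective m -> (forall x, m x <> x) ->
  forall x, m x = turn (if m Back is Forth then true else false) x.
Proof.
move=> m_inj m_id x.
have mBF : m Back <> m Forth by move/m_inj.
have mFR : m Forth <> m Rung by move/m_inj.
have mRB : m Rung <> m Back by move/m_inj.
move: (m_id Back) (m_id Forth) (m_id Rung) => mB mF mR.
by case: x; case eB: (m Back); case eF: (m Forth); case eR: (m Rung) => //=;
  congruence.
Qed.

Section RotationSystems.
Variable N : nat.
Local Notation ldart := (dart (closed_end_ladder N.+1)).

Lemma vertex_of_porbit r (d d' : ldart) :
  d' \in porbit (rotation r) d -> vertex_of d' = vertex_of d.
Proof.
case/porbitP=> i ->; elim: i => [|i IHi]; first by rewrite perm1.
by rewrite expgSr permM permE /rotate vertex_of_dart_at -surjective_pairing.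
Qed.

Lemma rotation_system_rotation r : rotation_system (rotation r : {perm ldart}).
Proof.
apply/forallP=> d; apply/eqP/setP=> d'; rewrite inE.
apply/idP/eqP=> [/vertex_of_porbit //|vd].
rewrite -[d]dart_atE -[d']dart_atE.
rewrite (_ : vertex_of d' = vertex_of d) //; case: (vertex_of d) => b l /=.
have step x : porbit (rotation r) (dart_at b l (turn (r (b, l)) x)) =
              porbit (rotation r) (dart_at b l x).
  by rewrite -[RHS]porbit_step permE rotate_dart_at.
rewrite -eq_porbit_mem; move: (step Back) (step Forth) (step Rung).
by case: (r (b, l)); case: (side_of d); case: (side_of d') => //= -> // ->.
Qed.

Definition turns_forth (s : {perm ldart}) (v : bool * 'I_N.+1) : bool :=
  s (dart_at v.1 v.2 Back) == dart_at v.1 v.2 Forth.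

Lemma dart_at_inj b l : injective (dart_at b l : side -> ldart).
Proof. by move=> x y /(congr1 (@side_of _)); rewrite !side_of_dart_at. Qed.

Lemma turns_forth_rotation r v : turns_forth (rotation r) v = r v.
Proof.
rewrite /turns_forth permE rotate_dart_at -surjective_pairing.
by case: (r v); [rewrite eqxx | apply/eqP=> /dart_at_inj].
Qed.

Lemma rotation_systemE (s : {perm ldart}) :
  rotation_system s -> s = rotation (turns_forth s).
Proof.
move=> /forallP s_rot; apply/permP=> d; rewrite permE -[d]dart_atE rotate_dart_at.
case: (vertex_of d) => b l /=; move: (side_of d) => {d}.
pose m x := side_of (s (dart_at b l x)).
have s_at x : s (dart_at b l x) = dart_at b l (m x).
  rewrite -[LHS]dart_atE -/(m x) (_ : vertex_of _ = (b, l)) //.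
  have := mem_porbit s 1 (dart_at b l x).
  rewrite (eqP (s_rot _)) inE expg1 => /eqP.
  by rewrite -!/(vertex_of _) vertex_of_dart_at.
have m_inj : injective m.
  by move=> x y mxy; apply/(@dart_at_inj b l)/(@perm_inj _ s); rewrite !s_at mxy.
(* A fixed dart would be a whole cycle, although its vertex carries the further dart [y]. *)
have m_id x : m x <> x.
  move=> mx; pose y := turn true x.
  have : dart_at b l y \in porbit s (dart_at b l x).
    by rewrite (eqP (s_rot _)) inE -!/(vertex_of _) !vertex_of_dart_at.
  case/porbitP=> i.
  have -> : (s ^+ i)%g (dart_at b l x) = dart_at b l x.
    by elim: i => [|i IHi]; rewrite ?perm1 // expgSr permM IHi s_at mx.
  by move/dart_at_inj; rewrite /y; case: x {mx y}.
have -> : turns_forth s (b, l) = if m Back is Forth then true else false.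
  rewrite /turns_forth s_at; apply/eqP/idP => [/dart_at_inj -> //|].
  by case: (m Back).
by move=> x; rewrite s_at -turn_derangement.
Qed.

Lemma genus_count_tuples i :
  genus_count (closed_end_ladder N.+1) i =
  #|[set t : N.+1.-tuple (bool * bool) | faces true t + 2 * i == N.+3]|.
Proof.
pose rot t : {perm ldart} := rotation (@orientation N.+1 t).
have rot_inj : injective rot.
  move=> t t' tt'; apply: eq_from_tnth => l.
  have orE b : orientation t (b, l) = orientation t' (b, l).
    have := turns_forth_rotation (orientation t) (b, l).
    by rewrite -/(rot t) tt' turns_forth_rotation.
  have := orE true; have := orE false; rewrite /orientation /=.
  by case: (tnth t l) (tnth t' l) => x y [x' y'] /= -> ->.
have genus_rot t : has_genus (rot t) i = (faces true t + 2 * i == N.+3).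
  rewrite /has_genus /face_count -trace_true card_porbits_trace.
  (* There are [2 * N.+1] vertices and [3 * N.+1] edges; their difference plus 2 is [N.+3]. *)
  rewrite !(card_prod, card_sum, card_bool, card_ord).
  rewrite (_ : 2 * N + _ + 2 = 2 * N.+1 + N.+3) -?addnA ?eqn_add2l //.
  by rewrite /=; lia.
rewrite /genus_count -(card_imset _ rot_inj); congr #|pred_of_set _|.
apply/setP=> s; rewrite inE; apply/andP/imsetP => [[s_rot s_genus]|[t]].
  pose t := [tuple (turns_forth s (false, l), turns_forth s (true, l)) | l < N.+1].
  have st : s = rot t.
    rewrite {1}(rotation_systemE s_rot); apply/permP=> d; rewrite !permE /rotate.
    congr (dart_at _ _ (turn _ _)); rewrite /orientation tnth_mktuple.
    by case: (vertex_of d) => -[].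
  by exists t; rewrite // inE -genus_rot -st.
by rewrite inE -genus_rot => gt ->; split=> //; apply: rotation_system_rotation.
Qed.

End RotationSystems.

(** * Recursion for the genus counts *)

Lemma card_cons_tuple (A : finType) n (P : pred (seq A)) :
  #|[set t : n.+1.-tuple A | P t]| =
  \sum_(a : A) #|[set t : n.-tuple A | P (a :: t)]|.
Proof.
under [RHS]eq_bigr => a _ do rewrite -sum1dep_card.
rewrite pair_big_dep /= -sum1dep_card.
rewrite (reindex (fun u : A * n.-tuple A => [tuple of u.1 :: u.2])) //=.
exists (fun t : n.+1.-tuple A => (thead t, [tuple of behead t])) => [[a t]|t] _ /=.
  by congr pair; apply: val_inj.
by rewrite -tuple_eta.
Qed.

(* The Euler relation of the ladder with [n] rungs is [faces + 2 i = n + 2]; if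
   the strands return from their own sides ([p = false]), one face is missing. *)
Definition genus_tuples p n i :=
  #|[set t : n.-tuple (bool * bool) | faces p t + 2 * i == n + p.+1]|.

Lemma sum_bool_pair (F : bool * bool -> nat) :
  \sum_a F a = F (true, true) + F (true, false) + F (false, true) + F (false, false).
Proof.
rewrite (eq_bigr (fun a => F (a.1, a.2))) => [|[] //].
by rewrite -(pair_big predT predT (fun x y => F (x, y))) !big_bool /= !addnA.
Qed.

(** In terms of the Euler relation, no genus is negative. This discards the equal pairs when the
    genus is 0. *)
Lemma faces_bound p s : faces p s <= size s + p.+1.
Proof.
elim: s p => [|[x y] s IHs] p //=; have := IHs (next_flip p (x, y)).
by case: p x y => -[] [] /=; lia.
Qed.

Lemma genus_tuples0 p i : genus_tuples p 0 i = (i == 0).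
Proof.
rewrite /genus_tuples; case: i => [|i] /=.
  rewrite (_ : [set _ | _] = setT) ?cardsT ?card_tuple //.
  by apply/setP=> t; rewrite [t]tuple0 !inE /= addn0 eqxx.
by apply/eqP; rewrite cards_eq0; apply/eqP/setP=> t; rewrite [t]tuple0 !inE /=; lia.
Qed.

(** From same-side strands all four pairs lead to crossing strands, without closing a face. *)
Lemma genus_tuples_false n i : genus_tuples false n.+1 i = 4 * genus_tuples true n i.
Proof.
rewrite /genus_tuples (card_cons_tuple n (fun t => faces false t + 2 * i == n.+1 + 1)).
rewrite sum_bool_pair /=.
have -> : [set t : n.-tuple (bool * bool) | 0 + faces true t + 2 * i == n.+1 + 1] =
          [set t : n.-tuple _ | faces true t + 2 * i == n + 2].
  by apply/setP=> t; rewrite !inE; move: (faces _ _) => k; lia.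
by move: #|_| => x; lia.
Qed.

Lemma genus_tuples_true0 n : genus_tuples true n.+1 0 = 2 * genus_tuples true n 0.
Proof.
rewrite /genus_tuples (card_cons_tuple n (fun t => faces true t + 2 * 0 == n.+1 + 2)).
rewrite sum_bool_pair /=.
have -> : [set t : n.-tuple (bool * bool) |
           0 + faces false t + 2 * 0 == n.+1 + 2] = set0.
  apply/setP=> t; rewrite !inE; have := faces_bound false t.
  by rewrite size_tuple; move: (faces _ _) => k /=; lia.
have -> : [set t : n.-tuple (bool * bool) | 1 + faces true t + 2 * 0 == n.+1 + 2] =
          [set t : n.-tuple _ | faces true t + 2 * 0 == n + 2].
  by apply/setP=> t; rewrite !inE; move: (faces _ _) => k; lia.
rewrite cards0.
by move: #|_| => x; lia.
Qed.

(** The two unequal pairs close a face and keep the genus; the two equal pairs close none and use up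
    one handle. *)
Lemma genus_tuples_trueS n i : genus_tuples true n.+1 i.+1 =
  2 * genus_tuples true n i.+1 + 2 * genus_tuples false n i.
Proof.
rewrite /genus_tuples (card_cons_tuple n (fun t => faces true t + 2 * i.+1 == n.+1 + 2)).
rewrite sum_bool_pair /=.
have -> : [set t : n.-tuple (bool * bool) | 0 + faces false t + 2 * i.+1 == n.+1 + 2] =
          [set t : n.-tuple _ | faces false t + 2 * i == n + 1].
  by apply/setP=> t; rewrite !inE; move: (faces _ _) => k; lia.
have -> : [set t : n.-tuple (bool * bool) | 1 + faces true t + 2 * i.+1 == n.+1 + 2] =
         [set t : n.-tuple _ | faces true t + 2 * i.+1 == n + 2].
  by apply/setP=> t; rewrite !inE; move: (faces _ _) => k; lia.
by move: #|_| #|_| => x y; lia.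
Qed.

(** * Closed form and ratios of consecutive coefficients *)

Definition ladder_coef n i := 'C(n.+1 - i, i) + 'C(n - i, i).

(** Pascal's rule survives truncated subtraction: for [i > m] every binomial has upper index 0 and
    positive lower index. *)
Lemma bin_sub_recl m i : 'C(m.+1 - i, i.+1) = 'C(m - i, i.+1) + 'C(m - i, i).
Proof.
case: (leqP i m) => [le_im|lt_mi]; first by rewrite subSn // binS.
have -> : m - i = 0 by lia.
have -> : m.+1 - i = 0 by lia.
by rewrite !bin0n; case: i lt_mi.
Qed.

Lemma ladder_coefS n i :
  ladder_coef n.+2 i.+1 = ladder_coef n.+1 i.+1 + ladder_coef n i.
Proof. by rewrite /ladder_coef !subSS !bin_sub_recl; lia. Qed.

(** The factor 2 on the left avoids the exponent [n - 1 + i], which would truncate at [n = i = 0].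
    The recursion has order two, so the induction carries two consecutive values of [n]. *)
Lemma genus_tuplesE n i :
  2 * genus_tuples true n i = 2 ^ (n + i) * ladder_coef n i.
Proof.
suff: 2 * genus_tuples true n i = 2 ^ (n + i) * ladder_coef n i /\
      2 * genus_tuples true n.+1 i = 2 ^ (n.+1 + i) * ladder_coef n.+1 i by case.
elim: n i => [|n IHn] i.
  case: i => [|i]; first by rewrite genus_tuples_true0 !genus_tuples0.
  rewrite genus_tuples_trueS !genus_tuples0 /ladder_coef !subSS !sub0n !bin0n.
  by case: i => [|i]; rewrite ?bin0n /= ?muln0.
split; first by case: (IHn i).
case: i => [|i].
  rewrite genus_tuples_true0; have [_ ->] := IHn 0.
  by rewrite /ladder_coef !bin0 !addn0 [in RHS]expnS; lia.
rewrite genus_tuples_trueS genus_tuples_false ladder_coefS.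
have [_ e1] := IHn i.+1; have [e2 _] := IHn i; move: e1 e2.
move: (genus_tuples _ _ _) (genus_tuples _ _ _) => x y.
rewrite !addSn !addnS !expnS; move: (2 ^ _) => z; nia.
Qed.

(** The binomials are [(i + j)! / (i! j!)] and [j] times [(i + j - 1)! / (i! j!)]; the last factor
    is [(i + j) + j]. *)
Lemma ladder_coef_fact n i j : n.+1 = 2 * i + j ->
  ladder_coef n i * (i`! * j`!) = (i + j).-1`! * (i + 2 * j).
Proof.
move=> def_n; rewrite /ladder_coef mulnDl.
have -> : n.+1 - i = i + j by lia.
have -> : n - i = (i + j).-1 by lia.
have := bin_fact (leq_addr j i); rewrite addKn => ->.
case: j def_n => [|j] def_n.
  case: i def_n => [|i] def_n; first by lia.
  by rewrite addn0 bin_small //= factS; nia.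
rewrite addnS /=; have := bin_fact (leq_addr j i); rewrite addKn.
rewrite !factS; move: 'C(_, _) => x e; nia.
Qed.

(** Quotient of two instances of [ladder_coef_fact], with [j.+2] at [i] and [j] at [i.+1], cleared
    of denominators. *)
Lemma ladder_coef_ratio n i j : n = 2 * i + j + 1 ->
  ladder_coef n i.+1 * (i.+1 * (i + j).+1 * (i + 2 * j + 4)) =
  ladder_coef n i * (j.+2 * j.+1 * (i + 2 * j + 1)).
Proof.
move=> def_n.
have : ladder_coef n i.+1 * (i.+1`! * j`!) = (i + j)`! * (i.+1 + 2 * j).
  by apply: ladder_coef_fact; lia.
have : ladder_coef n i * (i`! * j.+2`!) = (i + j).+1`! * (i + 2 * j.+2).
  by rewrite ladder_coef_fact ?addnS //; lia.
rewrite !factS.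
have := fact_gt0 i; have := fact_gt0 j; have := fact_gt0 (i + j).
move: (i`!) (j`!) ((i + j)`!) (ladder_coef _ _) (ladder_coef _ _).
move=> x y z c c' z0 y0 x0 e2 e1.
apply/eqP; rewrite -(eqn_pmul2r (_ : 0 < x * y)) ?muln_gt0 ?x0 //; apply/eqP.
transitivity (z * (i.+1 + 2 * j) * ((i + j).+1 * (i + 2 * j + 4))).
  by rewrite -e1; ring.
transitivity ((i + j).+1 * z * (i + 2 * j.+2) * (i + 2 * j + 1)).
  by ring.
by rewrite -e2; ring.
Qed.

Lemma ladder_coef_gt0 n i : 2 * i <= n.+1 -> 0 < ladder_coef n i.
Proof. by move=> ?; rewrite addn_gt0 bin_gt0; apply/orP; left; lia. Qed.

Lemma ladder_coef_eq0 n i : n.+1 < 2 * i -> ladder_coef n i = 0.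
Proof. by move=> ?; rewrite /ladder_coef !bin_small //; lia. Qed.

Lemma ladder_coef_log_concave n i :
  ladder_coef n i * ladder_coef n i.+2 <= ladder_coef n i.+1 ^ 2.
Proof.
case: (ltnP n.+1 (2 * i.+2)) => [/ladder_coef_eq0 ->|le_i]; first by rewrite muln0.
have [j def_n] : exists j, n = 2 * i + j + 3 by exists (n - 3 - 2 * i); lia.
have e1 := @ladder_coef_ratio n i j.+2 (ltac:(lia)).
have e2 := @ladder_coef_ratio n i.+1 j (ltac:(lia)).
set A1 := j.+4 * _ * _ in e1; set B1 := _ * (_ + 4) in e1.
set A2 := j.+2 * _ * _ in e2; set B2 := _ * (_ + 4) in e2.
(* The ratios at [i] and [i.+1] are [A1 / B1] and [A2 / B2]; log-concavity says that the second is
   no larger. *)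
have AB_gt0 : 0 < A1 * B2 by rewrite !muln_gt0 /= !addn_gt0 /= !orbT.
have AB_le : A2 * B1 <= A1 * B2.
  have -> : A2 * B1 =
      (j + 2) * (j + 1) * (i + j + 3) * (i + 1) * ((i + 2 * j + 2) * (i + 2 * j + 8)).
    by rewrite /A2 /B1; ring.
  have -> : A1 * B2 =
      (j + 4) * (j + 3) * (i + j + 2) * (i + 2) * ((i + 2 * j + 5) * (i + 2 * j + 5)).
    by rewrite /A1 /B2; ring.
  (* The factors are compared in three groups, each difference being a polynomial with nonnegative
     coefficients. *)
  apply: leq_mul; first apply: leq_mul; last 2 first.
  - by rewrite leq_add2l.
  - rewrite (_ : (i + 2 * j + 5) * _ =
      (i + 2 * j + 2) * (i + 2 * j + 8) + 9); last by ring.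
    exact: leq_addr.
  rewrite (_ : (j + 4) * _ * _ = (j + 2) * (j + 1) * (i + j + 3) +
    (3 * (j * j) + 15 * j + 18 + 4 * (i * j) + 10 * i)); last by ring.
  exact: leq_addr.
rewrite -(leq_pmul2r AB_gt0).
have -> : ladder_coef n i * ladder_coef n i.+2 * (A1 * B2) =
  (ladder_coef n i * A1) * (ladder_coef n i.+2 * B2) by ring.
rewrite -e1 e2.
have -> : ladder_coef n i.+1 * B1 * (ladder_coef n i.+1 * A2) =
  ladder_coef n i.+1 ^ 2 * (A2 * B1) by ring.
by rewrite leq_mul2l AB_le orbT.
Qed.

Lemma ladder_coef_increases n i : 2 <= n -> 3 * i.+1 <= n + 2 ->
  ladder_coef n i < 2 * ladder_coef n i.+1.
Proof.
move=> n_ge2 le_i.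
(* Here [k] is [j - i], nonnegative by the bound on [i]. *)
have [k def_n] : exists k, n = 2 * i + (i + k) + 1 by exists (n - 1 - 3 * i); lia.
have e := ladder_coef_ratio def_n.
have c_gt0 : 0 < ladder_coef n i by apply: ladder_coef_gt0; lia.
set A := (i + k).+2 * _ * _ in e; set B := _ * (_ + 4) in e.
have B_gt0 : 0 < B by rewrite !muln_gt0 /= !addn_gt0 /= !orbT.
have AB : B < 2 * A.
  (* At [k = 0] the gap is [3 * i * i.+1], and [n = 3 * i + 1] with [n >= 2] forces [i > 0]. For
     [n = 1] the counts at genus 0 and 1 tie. *)
  case: k def_n @A @B {e B_gt0} => [|k] def_n A B.
    have -> : 2 * A = B + 3 * i * i.+1 by rewrite /A /B; ring.
    by rewrite -[X in X < _]addn0 ltn_add2l !muln_gt0 /=; lia.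
  have -> : B = (i + 1) * (3 * i + 2 * k + 6) * (2 * i + k + 2) by rewrite /B; ring.
  have -> : 2 * A = (i + k + 3) * (3 * i + 2 * k + 3) * (2 * i + 2 * k + 4).
    by rewrite /A; ring.
  have le1 : (i + 1) * (3 * i + 2 * k + 6) <= (i + k + 3) * (3 * i + 2 * k + 3).
    rewrite (_ : (i + k + 3) * _ = (i + 1) * (3 * i + 2 * k + 6) +
      (3 * (i * k) + 3 * i + 2 * (k * k) + 7 * k + 3)); last by ring.
    exact: leq_addr.
  apply: leq_ltn_trans (leq_mul le1 (leqnn _)) _.
  by rewrite ltn_pmul2l ?muln_gt0 ?addn_gt0 ?orbT //; lia.
by rewrite -(ltn_pmul2r B_gt0) -mulnA e mulnCA ltn_pmul2l.
Qed.

Lemma ladder_coef_decreases n i : n + 2 < 3 * i.+1 -> 2 * i <= n.+1 ->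
  2 * ladder_coef n i.+1 < ladder_coef n i.
Proof.
move=> gt_i /ladder_coef_gt0 c_gt0.
case: (ltnP n.+1 (2 * i.+1)) => [/ladder_coef_eq0 -> //|le_i].
have [j def_n] : exists j, n = 2 * i + j + 1 by exists (n - 1 - 2 * i); lia.
(* The lower bound on [i] now says [j < i]. *)
have [k def_i] : exists k, i = j + k.+1 by exists (i - j).-1; lia.
have e := ladder_coef_ratio def_n.
set A := j.+2 * _ * _ in e; set B := _ * (_ + 4) in e.
have B_gt0 : 0 < B by rewrite !muln_gt0 /= !addn_gt0 /= !orbT.
have AB : 2 * A < B.
  rewrite (_ : 2 * A = (j + 2) * (2 * j + 2) * (i + 2 * j + 1)); last by rewrite /A; ring.
  have le1 : (j + 2) * (2 * j + 2) <= i.+1 * (i + j).+1 by apply: leq_mul; lia.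
  apply: leq_ltn_trans (leq_mul le1 (leqnn _)) _.
  by rewrite ltn_pmul2l ?muln_gt0 // !addnS !ltnS addn0; lia.
by rewrite -(ltn_pmul2r B_gt0) -mulnA e mulnCA ltn_pmul2l.
Qed.

(** * Log-concavity and peak of the genus counts *)

Lemma genus_tuples_gt0 n i : 2 * i <= n.+1 -> 0 < genus_tuples true n i.
Proof.
move=> /ladder_coef_gt0 c_gt0; rewrite -(ltn_pmul2l (_ : 0 < 2)) // genus_tuplesE muln0.
by rewrite muln_gt0 expn_gt0.
Qed.

Lemma genus_tuples_eq0 n i : n.+1 < 2 * i -> genus_tuples true n i = 0.
Proof.
move=> /ladder_coef_eq0 c0; have := genus_tuplesE n i; rewrite c0 muln0.
by move/eqP; rewrite muln_eq0 => /eqP.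
Qed.

(** The powers of two form a geometric progression, so they cancel and leave the inequality for
    [ladder_coef]. *)
Lemma genus_tuples_log_concave n i :
  genus_tuples true n i * genus_tuples true n i.+2 <= genus_tuples true n i.+1 ^ 2.
Proof.
rewrite -(leq_pmul2l (_ : 0 < 2 ^ 2)) // -expnMn genus_tuplesE.
rewrite {1}expnS expn1 mulnACA !genus_tuplesE mulnACA -expnD expnMn -expnM.
rewrite (_ : n + i + (n + i.+2) = (n + i.+1) * 2); last by lia.
by rewrite leq_mul2l ladder_coef_log_concave orbT.
Qed.

Lemma genus_tuples_increases n i : 2 <= n -> 3 * i.+1 <= n + 2 ->
  genus_tuples true n i < genus_tuples true n i.+1.
Proof.
move=> n_ge2 le_i; rewrite -(ltn_pmul2l (_ : 0 < 2)) // !genus_tuplesE addnS expnSr -mulnA.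
by rewrite ltn_pmul2l ?expn_gt0 // ladder_coef_increases.
Qed.

Lemma genus_tuples_decreases n i : n + 2 < 3 * i.+1 -> 2 * i <= n.+1 ->
  genus_tuples true n i.+1 < genus_tuples true n i.
Proof.
move=> gt_i le_i; rewrite -(ltn_pmul2l (_ : 0 < 2)) // !genus_tuplesE addnS expnSr -mulnA.
by rewrite ltn_pmul2l ?expn_gt0 // ladder_coef_decreases.
Qed.

Lemma geq_bigmin_cond (I : eqType) (s : seq I) (P : pred I) (F : I -> nat) m i0 :
  i0 \in s -> P i0 -> \big[minn/m]_(i <- s | P i) F i <= F i0.
Proof.
move=> + Pi0; elim: s => // i s IHs; rewrite inE big_cons => /predU1P[<-|/IHs le_s].
  by rewrite Pi0 geq_minl.
by case: ifP => // _; apply: leq_trans le_s; apply: geq_minr.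
Qed.

Lemma genus_countE n i : 1 <= n ->
  genus_count (closed_end_ladder n) i = genus_tuples true n i.
Proof.
by case: n => // n _; rewrite genus_count_tuples /genus_tuples addn2.
Qed.

Theorem corollary4p5 (n : nat) (n_ge1 : 1 <= n) :
  genus_distribution_log_concave (closed_end_ladder n) /\
  (2 <= n -> is_genus_distribution_peak (closed_end_ladder n) ((n + 2) %/ 3)).
Proof.
have countE i := genus_countE i n_ge1; split.
  by move=> [|i] // _ _; rewrite !countE genus_tuples_log_concave.
move=> n_ge2; set m := (n + 2) %/ 3.
have m_le : 3 * m <= n + 2 by rewrite /m; lia.
have m_gt : n + 2 < 3 * m.+1 by rewrite /m; lia.
(* [m] must be an index of the bounded operators defining the extreme genera; as genus [m] is
   attained, it lies between them. *)
have m_edge : m < #|edge (closed_end_ladder n)|.+1.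
  rewrite !(card_prod, card_sum, card_bool, card_ord) prednK //; lia.
pose m_ord := Ordinal m_edge.
have count_m : 0 < genus_count (closed_end_ladder n) m_ord.
  by rewrite countE genus_tuples_gt0 //=; lia.
have min_m : min_genus (closed_end_ladder n) <= m.
  exact: (@geq_bigmin_cond _ _ _ val _ m_ord (mem_index_enum _)).
have max_m : m <= max_genus (closed_end_ladder n) by apply: (leq_bigmax_cond m_ord).
split; split=> //.
- by move=> i _ lt_im; rewrite !countE ltnW ?genus_tuples_increases //; lia.
- move=> min_lt; rewrite !countE -{2}(prednK (leq_ltn_trans _ min_lt)) //.
  by rewrite genus_tuples_increases //; lia.
- by move=> i le_mi le_im; congr genus_count; lia.
- by move=> _; rewrite !countE genus_tuples_decreases //; lia.
move=> i lt_mi _; rewrite !countE.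
(* Strict decrease holds on the support; beyond it the counts vanish. *)
case: (leqP (2 * i) n.+1) => [le_i|lt_i].
  by rewrite ltnW ?genus_tuples_decreases //; lia.
by rewrite genus_tuples_eq0 //; lia.
Qed.
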